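(* Let $R$ be a commutative ring with $1$ and let $I_2$ be the ideal of $R$ generated by the elements $r^2-r$, $r\in R$. As an $R$-module, $I_2$ is generated by the elements $\varpi_r=r^2-r$, $r\in R$, subject only to the formal relations $$\varpi_{r+s}=\varpi_r+\varpi_s+rs\,\varpi_2,\qquad \varpi_{rs}=r\,\varpi_s+s^2\,\varpi_r$$ for $r$ and $s$ in $R$ (i.e. these generators and relations form a presentation of the $R$-module $I_2$). *)

(* Defs.v *)
From HB Require Import structures.
From mathcomp Require Import all_boot all_algebra finmap.
From mathcomp Require Import boolp classical_sets.
From mathcomp.multinomials Require Import monalg.

Set Implicit Arguments.
Unset Strict Implicit.
Unset Printing Implicit Defensive.

Import GRing.Theory.

Local Open Scope classical_set_scope.
Local Open Scope ring_scope.

Section LinearSpan.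
Variables (R : pzRingType) (M : lmodType R).

Definition lspan (S : set M) : set M :=
  [set m | exists2 s : seq (R * M),
     forall p, p \in s -> S p.2 & m = \sum_(p <- s) p.1 *: p.2].

Lemma lspan_submod_closed (S : set M) :
  submod_closed (fun m => `[< lspan S m >] : bool).
Proof.
split=> [|a u v /asboolP[s Ss ->] /asboolP[t St ->]]; apply/asboolP.
  by exists [::] => //; rewrite big_nil.
exists ([seq (a * p.1, p.2) | p <- s] ++ t) => [p|].
  by rewrite mem_cat => /orP[/mapP[q /Ss Sq ->] | /St].
rewrite big_cat big_map scaler_sumr; congr (_ + _).
by apply: eq_bigr => p _; rewrite scalerA.
Qed.

End LinearSpan.

(* The free module R^(X). It is an alias of {malg R[X]}, whose own lmodType
   structure requires 1 != 0 in R. *)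
Definition freemod (R : pzRingType) (X : choiceType) : Type := {malg R[X]}.

Section FreeModule.
Variables (R : pzRingType) (X : choiceType).

HB.instance Definition _ := GRing.Zmodule.on (freemod R X).

Definition freemod_scale (a : R) (z : freemod R X) : freemod R X :=
  [malg x in msupp z => a * z@_x].

Lemma freemod_scaleE a z x : (freemod_scale a z)@_x = a * z@_x.
Proof. by rewrite mcoeffE; case: msuppP; rewrite ?mulr0. Qed.

Lemma freemod_scaleA a b z :
  freemod_scale a (freemod_scale b z) = freemod_scale (a * b) z.
Proof. by apply/malgP => x; rewrite !freemod_scaleE mulrA. Qed.

Lemma freemod_scale1 : left_id 1 freemod_scale.
Proof. by move=> z; apply/malgP => x; rewrite freemod_scaleE mul1r. Qed.

Lemma freemod_scaleDr : right_distributive freemod_scale +%R.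
Proof.
by move=> a y z; apply/malgP => x; rewrite mcoeffD !freemod_scaleE mcoeffD mulrDr.
Qed.

Lemma freemod_scaleDl z : {morph freemod_scale^~ z : a b / a + b}.
Proof.
by move=> a b; apply/malgP => x; rewrite mcoeffD !freemod_scaleE mulrDl.
Qed.

HB.instance Definition _ := GRing.Zmodule_isLmodule.Build R (freemod R X)
  freemod_scaleA freemod_scale1 freemod_scaleDr freemod_scaleDl.

Definition freemod_gen (x : X) : freemod R X := mkmalgU x 1.

(* The linear map R^(X) -> M sending the basis vector of index x to g x. *)
Definition freemod_lift (M : lmodType R) (g : X -> M) (z : freemod R X) : M :=
  \sum_(x <- msupp z) z@_x *: g x.

Definition is_presentation (M : lmodType R) (g : X -> M)
    (rels : set (freemod R X)) : Prop :=
  (forall m : M, exists z, freemod_lift g z = m) /\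
  (forall z, freemod_lift g z = 0 <-> lspan rels z).

End FreeModule.

Section I2.
Variable R : comPzRingType.

Definition sqr_sub (r : R) : R^o := r ^+ 2 - r.

(* Ideals of R are the submodules of R^o. *)
Definition mem_I2 : {pred R^o} := fun x => `[< lspan (range sqr_sub) x >].

Fact mem_I2_submod_closed : submod_closed mem_I2.
Proof. exact: lspan_submod_closed. Qed.

HB.instance Definition _ :=
  GRing.isSubmodClosed.Build R R^o mem_I2 mem_I2_submod_closed.

Record I2 : Type := MkI2 { I2_val : R^o; I2_valP : I2_val \in mem_I2 }.

HB.instance Definition _ := [isSub for I2_val].
HB.instance Definition _ := [Choice of I2 by <:].
HB.instance Definition _ := [SubChoice_isSubLmodule of I2 by <:].

Fact sqr_sub_I2 (r : R) : sqr_sub r \in mem_I2.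
Proof.
apply/asboolP; exists [:: (1, sqr_sub r)] => [p|].
  by rewrite mem_seq1 => /eqP ->; exists r.
by rewrite big_seq1 scale1r.
Qed.

Definition varpi (r : R) : I2 := MkI2 (sqr_sub_I2 r).

Local Notation e r := (freemod_gen R (r : R)).

Variant I2_rels : set (freemod R R) :=
| I2_relD r s : I2_rels (e (r + s) - (e r + e s + (r * s) *: e 2%:R))
| I2_relM r s : I2_rels (e (r * s) - (r *: e s + s ^+ 2 *: e r)).

End I2.

(* Main.v *)
From HB Require Import structures.
Require Import Defs.
From mathcomp Require Import all_boot all_algebra.
From mathcomp Require Import finmap boolp classical_sets ring.
From mathcomp.multinomials Require Import monalg.

(** The relations are enough because the generators are indexed by the whole of
    [R]: the image in [R] of a combination of generators is itself the index of
    a generator, and that generator determines the combination when the image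
    is [0].

    Let [N] be any module containing a family [w r] that satisfies the two
    relations, and let [t = \sum_i a_i (r_i ^ 2 - r_i)] be the image in [R] of
    [z = \sum_i a_i w_(r_i)]. The product relation, read for [r s] and for
    [s r], gives the exchange rule [(r ^ 2 - r) w_s = (s ^ 2 - s) w_r]
    ([w_exchange]), hence [t w_s = (s ^ 2 - s) z] for every [s]. The relations
    also give [w_(r ^ 2 - r) = (r ^ 2 - r - 1) w_r] ([w_sqr_sub]), and using
    the exchange rule this propagates to all combinations ([recovers_sum]):
    [w_t = (t - 1) z]. When [t = 0] the left side is [w_0 = 0] and the right
    side is [- z], so [z = 0] ([w_syzygy]).

    This is applied to the module presented by the generators and relations,
    that is, the quotient of the free module by the span of the relators: a
    formal combination with image [0] in the ideal is [0] in that quotient,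
    so it lies in the span of the relators. The remaining claims, that the
    [r ^ 2 - r] generate the ideal and satisfy the relations, are direct. *)

Set Implicit Arguments.
Unset Strict Implicit.
Unset Printing Implicit Defensive.

Import GRing.Theory.

Local Open Scope ring_scope.
Local Open Scope quotient_scope.

(** * The quotient of a module by a span *)

Section SpanQuotient.
Variables (R : pzRingType) (M : lmodType R) (S : set M).

Definition in_lspan : {pred M} := fun m => `[< lspan S m >].

HB.instance Definition _ :=
  GRing.isSubmodClosed.Build R M in_lspan (lspan_submod_closed S).

Lemma in_lspanP x : reflect (lspan S x) (x \in in_lspan).
Proof. exact: asboolP. Qed.

Lemma sub_lspan x : S x -> lspan S x.
Proof.
move=> Sx; exists [:: (1, x)] => [p|]; last by rewrite big_seq1 scale1r.
by rewrite mem_seq1 => /eqP ->.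
Qed.

(** An alias of the quotient additive group, to carry the scalar action that is
    induced on it. *)
Definition spanquot : Type := Quotient.quot in_lspan.

HB.instance Definition _ := GRing.Zmodule.on spanquot.

Definition spanquot_pi (x : M) : spanquot := \pi_(Quotient.quot in_lspan) x.

Definition spanquot_scale (a : R) (q : spanquot) : spanquot :=
  spanquot_pi (a *: repr (q : Quotient.quot in_lspan)).

Lemma spanquot_piP x y : spanquot_pi x = spanquot_pi y <-> lspan S (x - y).
Proof.
split=> [/eqP|/in_lspanP]; first by rewrite -Quotient.idealrBE => /in_lspanP.
by rewrite Quotient.idealrBE => /eqP.
Qed.

Lemma spanquot_pi_eq0 x : spanquot_pi x = 0 <-> lspan S x.
Proof.
have <- : spanquot_pi 0 = 0 by exact: pi_zeror.
by rewrite spanquot_piP subr0.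
Qed.

Fact spanquot_piD : {morph spanquot_pi : x y / x + y}.
Proof. exact: Quotient.pi_add. Qed.

Fact spanquot_piZ a x : spanquot_pi (a *: x) = spanquot_scale a (spanquot_pi x).
Proof.
apply/spanquot_piP; rewrite -scalerBr; apply/in_lspanP.
apply: rpredZ; apply/in_lspanP/spanquot_piP.
by rewrite /spanquot_pi reprK.
Qed.

Fact spanquot_pi_surj q : exists x, q = spanquot_pi x.
Proof.
by exists (repr (q : Quotient.quot in_lspan)); rewrite /spanquot_pi reprK.
Qed.

Fact spanquot_scaleA a b q :
  spanquot_scale a (spanquot_scale b q) = spanquot_scale (a * b) q.
Proof.
by have [x ->] := spanquot_pi_surj q; rewrite -!spanquot_piZ scalerA.
Qed.

Fact spanquot_scale1 : left_id 1 spanquot_scale.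
Proof.
by move=> q; have [x ->] := spanquot_pi_surj q; rewrite -spanquot_piZ scale1r.
Qed.

Fact spanquot_scaleDr : right_distributive spanquot_scale +%R.
Proof.
move=> a p q; have [[x ->] [y ->]] := (spanquot_pi_surj p, spanquot_pi_surj q).
by rewrite -spanquot_piD -!spanquot_piZ scalerDr spanquot_piD.
Qed.

Fact spanquot_scaleDl q : {morph spanquot_scale^~ q : a b / a + b}.
Proof.
move=> a b; have [x ->] := spanquot_pi_surj q.
by rewrite -!spanquot_piZ scalerDl spanquot_piD.
Qed.

HB.instance Definition _ := GRing.Zmodule_isLmodule.Build R spanquot
  spanquot_scaleA spanquot_scale1 spanquot_scaleDr spanquot_scaleDl.

Fact spanquot_pi_is_linear : linear spanquot_pi.
Proof. by move=> a x y; rewrite spanquot_piD spanquot_piZ. Qed.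

HB.instance Definition _ :=
  GRing.isLinear.Build R M spanquot _ spanquot_pi spanquot_pi_is_linear.

End SpanQuotient.

(** * Linearity and uniqueness of the lift from a free module *)

Section FreeModuleLift.
Variables (R : pzRingType) (X : choiceType) (M : lmodType R) (g : X -> M).
Implicit Types (z : freemod R X) (x : X).

(** The supports of two elements differ from that of their sum, so sums over
    supports can only be compared after padding them to a common index set. *)
Lemma freemod_lift_widen (E : {fset X}) z :
  (msupp z `<=` E)%fset -> freemod_lift g z = \sum_(x <- E) z@_x *: g x.
Proof.
move=> sE; apply: big_fset_incl => // x _ /mcoeff_outdom ->.
by rewrite scale0r.
Qed.

Fact freemod_lift_is_linear : linear (freemod_lift g).
Proof.
move=> a y z; pose E := (msupp y `|` msupp z `|` msupp (a *: y + z))%fset.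
have sE v : (msupp v `<=` msupp y `|` msupp z)%fset || (v == a *: y + z) ->
    (msupp v `<=` E)%fset.
  by case/orP => [sv | /eqP ->]; rewrite fsubsetU ?sv // fsubset_refl orbT.
rewrite !(@freemod_lift_widen E) ?sE ?fsubsetUl ?fsubsetUr ?eqxx ?orbT //.
rewrite scaler_sumr -big_split; apply: eq_bigr => x _ /=.
by rewrite scalerA -scalerDl -(freemod_scaleE a y) -mcoeffD.
Qed.

HB.instance Definition _ :=
  GRing.isLinear.Build R (freemod R X) M _ (freemod_lift g)
    freemod_lift_is_linear.

Lemma freemod_lift_gen x : freemod_lift g (freemod_gen R x) = g x.
Proof.
rewrite (@freemod_lift_widen [fset x]%fset) ?msuppU_le // big_seq_fset1.
by rewrite mcoeffUU scale1r.
Qed.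

End FreeModuleLift.

(** A linear map out of a free module is the lift of its values on the basis;
    for a projection onto a quotient this turns lifts into classes. *)
Lemma freemod_lift_of_linear (R : pzRingType) (X : choiceType) (M : lmodType R)
    (f : {linear freemod R X -> M}) z :
  freemod_lift (fun x => f (freemod_gen R x)) z = f z.
Proof.
rewrite [in RHS](monalgE z).
rewrite -[RHS]/(f (\sum_(x <- msupp z) (mkmalgU x z@_x : freemod R X))).
rewrite raddf_sum; apply: eq_bigr => x _.
rewrite -linearZ; congr (f _); apply/malgP => y.
by rewrite freemod_scaleE !mcoeffU mulrnAr mulr1.
Qed.

(** * Consequences of the two relations *)

Section Relations.
Variables (R : comPzRingType) (N : lmodType R) (w : R -> N).
Hypothesis wD : forall r s, w (r + s) = w r + w s + (r * s) *: w 2%:R.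
Hypothesis wM : forall r s, w (r * s) = r *: w s + s ^+ 2 *: w r.

Lemma w0 : w 0 = 0.
Proof. by rewrite -(mulr0 0) wM expr2 mul0r !scale0r addr0. Qed.

Lemma w1 : w 1 = 0.
Proof.
by apply: (addrI (w 1)); rewrite addr0 -[in RHS](mulr1 1) wM expr1n scale1r.
Qed.

(** Both [w (r * s)] and [w (s * r)] expand by the product relation, and the
    two expansions differ because that relation is not symmetric. *)
Lemma w_exchange r s : (r ^+ 2 - r) *: w s = (s ^+ 2 - s) *: w r.
Proof.
rewrite !scalerBl; apply/eqP; rewrite subr_eq addrAC eq_sym subr_eq.
by rewrite addrC -wM mulrC wM addrC.
Qed.

Lemma wN r : w (- r) = w r + r *: w 2%:R.
Proof.
have wN1 : w (- 1) = w 2%:R.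
  have := wD 1 (-1); rewrite subrr mul1r scaleN1r w0 w1 add0r => /esym/eqP.
  by rewrite subr_eq0 => /eqP.
by rewrite -mulrN1 wM wN1 sqrrN expr1n scale1r addrC.
Qed.

(** Expanding [w (r * r + - r)] produces multiples of [w r] and of [w 2]; the
    coefficient of [w 2] is a multiple of [r ^+ 2 - r], so the exchange rule
    turns it into a multiple of [w r] as well. *)
Lemma w_sqr_sub r : w (r ^+ 2 - r) = (r ^+ 2 - r - 1) *: w r.
Proof.
(* The exchange rule at [s = 2], where [s ^+ 2 - s = 2]. *)
have w2 a : (a * (r ^+ 2 - r)) *: w 2%:R = (a * 2%:R) *: w r.
  by rewrite -scalerA w_exchange scalerA; congr (_ *: _); ring.
rewrite wD wN [in w _]expr2 wM -scalerDl.
transitivity ((r ^+ 2 + r + 1) *: w r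
              - ((r + 1) * (r ^+ 2 - r)) *: w 2%:R).
  rewrite addrA -[w r in LHS]scale1r scalerA -!addrA -scalerDl.
  by rewrite addrA -scalerDl -scaleNr; congr (_ *: _ + _ *: _); ring.
by rewrite w2 -scalerBl; congr (_ *: _); ring.
Qed.

(** The induction invariant linking a combination [z] of generators to its
    image [t] in [R]. The second clause is the goal; the first, which says that
    the exchange rule holds with [z] in place of a generator, is needed to add
    a further term. *)
Definition recovers (t : R) (z : N) : Prop :=
  (forall s, t *: w s = (s ^+ 2 - s) *: z) /\ w t = (t - 1) *: z.

Lemma recovers0 : recovers 0 0.
Proof. by split=> [s|]; rewrite ?w0 ?scale0r !scaler0. Qed.

Lemma w_scaled_sqr_sub a r :
  w (a * (r ^+ 2 - r)) = (a * (r ^+ 2 - r) - 1) *: (a *: w r).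
Proof.
rewrite wM w_sqr_sub [(_ - _) ^+ 2]expr2 -[(_ * _) *: w a]scalerA w_exchange.
by rewrite !scalerA -scalerDl; congr (_ *: _); ring.
Qed.

(** Writing [x = r ^+ 2 - r], the cross term [(a * x * t) *: w 2] of the sum
    relation equals [2 *: ((a * x) *: z)] by the first clause; the expansion of
    the right side has the cross terms [(a * x) *: z] and [t *: (a *: w r)],
    which agree by that same clause. *)
Lemma recoversD a r t z :
  recovers t z -> recovers (a * (r ^+ 2 - r) + t) (a *: w r + z).
Proof.
case=> tw wt; split=> [s|].
  rewrite [LHS]scalerDl tw [RHS]scalerDr -scalerA w_exchange !scalerA.
  by congr (_ *: _ + _); ring.
rewrite wD wt w_scaled_sqr_sub -[(_ * t) *: _]scalerA tw.
rewrite scalerDr -addrA; set x := r ^+ 2 - r.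
have -> : (a * x + t - 1) *: (a *: w r)
          = (a * x - 1) *: (a *: w r) + a *: (x *: z).
  by rewrite -tw !scalerA -scalerDl; congr (_ *: _); ring.
rewrite -addrA; congr (_ + _).
by rewrite !scalerA -!scalerDl; congr (_ *: _); ring.
Qed.

Lemma recovers_sum (c : R -> R) (s : seq R) :
  recovers (\sum_(r <- s) c r * (r ^+ 2 - r)) (\sum_(r <- s) c r *: w r).
Proof.
elim: s => [|r s IHs]; first by rewrite !big_nil; apply: recovers0.
by rewrite !big_cons; apply: recoversD.
Qed.

(** At [t = 0] the second clause of [recovers] reads [w 0 = - z]. *)
Lemma w_syzygy (c : R -> R) (s : seq R) :
  \sum_(r <- s) c r * (r ^+ 2 - r) = 0 -> \sum_(r <- s) c r *: w r = 0.
Proof.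
move=> t0; have [_] := recovers_sum c s.
by rewrite t0 w0 sub0r scaleN1r => /esym/eqP; rewrite oppr_eq0 => /eqP.
Qed.

End Relations.

(** * The presentation of the ideal *)

Theorem corollary3p7 (R : comPzRingType) :
  is_presentation (@varpi R) (@I2_rels R).
Proof.
have valM (z : freemod R R) :
    I2_val (freemod_lift (@varpi R) z)
    = \sum_(r <- msupp z) z@_r * (r ^+ 2 - r).
  by rewrite -[LHS]/(\val _) raddf_sum.
split=> [m | z].
  have [s gen_s def_m] : lspan (range (@sqr_sub R)) (I2_val m).
    exact/asboolP/(I2_valP m).
  suff [z def_z] : exists z, I2_val (freemod_lift (@varpi R) z) = I2_val m.
    by exists z; apply: val_inj.
  rewrite def_m; elim: s gen_s {def_m} => [|[a x] s IHs] gen_s.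
    by exists 0; rewrite big_nil linear0.
  have [|z def_z] := IHs.
    by move=> p sp; apply: gen_s; rewrite inE sp orbT.
  have [r _ /= def_x] := gen_s (a, x) (mem_head _ _).
  exists (a *: freemod_gen R r + z).
  rewrite [freemod_lift _ _]linearP /= freemod_lift_gen.
  by rewrite big_cons -def_z -def_x.
split=> [z0 | [s rel_s ->]].
  pose w r := spanquot_pi (@I2_rels R) (freemod_gen R r).
  apply/spanquot_pi_eq0; rewrite -freemod_lift_of_linear.
  apply: (@w_syzygy _ _ w); last by rewrite -valM z0.
  - move=> r s.
    rewrite /w -linearZ -!linearD; apply/spanquot_piP/sub_lspan.
    exact: I2_relD.
  - move=> r s.
    rewrite /w -!linearZ -!linearD; apply/spanquot_piP/sub_lspan.
    exact: I2_relM.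
rewrite linear_sum big_seq big1 // => p /rel_s rel_p.
suff lift0 : freemod_lift (@varpi R) p.2 = 0.
  by rewrite linearZ /= lift0 scaler0.
by case: rel_p => r s'; apply/val_inj;
  rewrite [freemod_lift _ _]linearB !linearD !linearZ /= !freemod_lift_gen;
  rewrite /= /sqr_sub /GRing.scale /=; ring.
Qed.
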